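(* For $s\in\mathbb R^C$ let $$\Omega^*_{\mathrm{RG}}(s)=\log C+\frac1C\sum_{j=1}^C s_j+\frac12\,s^\top\Bigl(\frac1C I-\frac1{C^2}\mathbf 1\mathbf 1^\top\Bigr)s ,$$ the second-order Taylor expansion of $\log\sum_{j=1}^C e^{s_j}$ at $0$, regarded as a deterministic (sampling-free) approximation of $\log\sum_{j=1}^C e^{s_j}$. Then its asymptotic bias and curvature bias are $$\mathrm{Bias}^{\mathrm{asym}}_{\mathrm{RG}}=\Omega^*_{\mathrm{RG}}(s)-\log\sum_{j=1}^C e^{s_j}=O(\|s\|^3),\qquad \mathrm{Bias}^{\mathrm{curv}}_{\mathrm{RG}}=0 .$$
   Context: $I$ is the $C\times C$ identity matrix and $\mathbf 1$ the all-ones vector in $\mathbb R^C$. Bias terms are defined as follows. An approximation of the log-partition function $\Omega^*_\star(s)=\log\sum_{j=1}^C e^{s_j}$ is written $\Omega^*(s;\xi)=g(X(\xi);\xi)$, where $\xi$ denotes the approximation mechanism and $X(\xi)=\frac1k\sum_{j=1}^k h(s_{y'_j},\xi)$ is an average over $k$ i.i.d. sampled classes $y'_j$, with mean $\mu_X$ and variance $\sigma_X^2$, and $g,h$ are scheme-specific smooth functions. The asymptotic bias is $g(\mu_X;\xi)-\Omega^*_\star(s)$ and the curvature bias is $\frac12 g''(\mu_X;\xi)\,\sigma_X^2$. A deterministic approximation corresponds to a degenerate $\xi$ without randomness (no sampling). *)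

(* Defs.v *)
From HB Require Import structures.
From mathcomp Require Import all_boot all_order all_algebra.
From mathcomp Require Import all_classical all_reals all_analysis.

Set Implicit Arguments.
Unset Strict Implicit.
Unset Printing Implicit Defensive.

Import Order.TTheory GRing.Theory Num.Theory.
Import numFieldNormedType.Exports.

Local Open Scope classical_set_scope.
Local Open Scope ring_scope.

(* The library norm on matrices is the sup norm. *)
Definition l2norm (R : realType) (n : nat) (s : 'cV[R]_n) : R :=
  Num.sqrt (\sum_(i < n) s i 0 ^+ 2).

Definition smooth_on (R : realType) (D : set R) (f : R -> R) : Prop :=
  forall (m : nat) (x : R), D x -> derivable (derive1n m f) x 1.

Definition taylor2 (R : realType) (n : nat) (f : 'cV[R]_n -> R)
    (a s : 'cV[R]_n) : R :=
  let e (i : 'I_n) : 'cV[R]_n := delta_mx i 0 in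
  f a + \sum_(i < n) 'D_(e i) f a * (s - a) i 0
      + 2^-1 * \sum_(i < n) \sum_(j < n)
          'D_(e i) ('D_(e j) f) a * (s - a) i 0 * (s - a) j 0.

Definition log_partition (R : realType) (C : nat) (s : 'cV[R]_C) : R :=
  ln (\sum_(j < C) expR (s j 0)).

Definition OmegaRG (R : realType) (C : nat) (s : 'cV[R]_C) : R :=
  let I : 'M[R]_C := 1%:M in
  let ones : 'cV[R]_C := const_mx 1 in
  ln C%:R + C%:R^-1 * \sum_(j < C) s j 0
  + 2^-1 * (s^T *m (C%:R^-1 *: I - (C%:R ^+ 2)^-1 *: (ones *m ones^T)) *m s) 0 0.

(* An approximation mechanism xi: k i.i.d. classes y_0, ..., y_{k-1}, sampled
   on the probability space (xi_space, xi_law), together with the functions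
   h( . , xi) and g( . , xi). The function g need only be smooth on an open
   interval containing the range of h, so that g = ln with h > 0 is allowed. *)
Record mechanism (R : realType) (C : nat) := Mechanism {
  xi_display : measure_display;
  xi_space : measurableType xi_display;
  xi_law : probability xi_space R;
  xi_k : nat;
  xi_y : 'I_xi_k -> xi_space -> 'I_C;
  xi_h : R -> R;
  xi_g : R -> R;
  xi_dom : set R;
  xi_k_gt0 : (0 < xi_k)%N;
  xi_y_measurable : forall (j : 'I_xi_k) (c : 'I_C),
    measurable (xi_y j @^-1` [set c]);
  xi_y_identically_distributed : forall (i j : 'I_xi_k) (c : 'I_C),
    xi_law (xi_y i @^-1` [set c]) = xi_law (xi_y j @^-1` [set c]);
  (* The classes are finite in number, so the product rule on atoms is mutual
     independence. *)
  xi_y_independent : forall c : 'I_xi_k -> 'I_C,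
    xi_law [set w | forall j, xi_y j w = c j] =
    (\prod_(j < xi_k) xi_law (xi_y j @^-1` [set c j]))%E;
  xi_dom_open : open xi_dom;
  xi_dom_interval : is_interval xi_dom;
  xi_h_dom : forall x, xi_dom (xi_h x);
  xi_h_smooth : smooth_on setT xi_h;
  xi_g_smooth : smooth_on xi_dom xi_g }.

Definition xi_X (R : realType) (C : nat) (xi : mechanism R C) (s : 'cV[R]_C)
    (w : xi_space xi) : R :=
  (xi_k xi)%:R^-1 * \sum_(j < xi_k xi) xi_h xi (s (xi_y j w) 0).

Definition xi_approx (R : realType) (C : nat) (xi : mechanism R C)
    (s : 'cV[R]_C) (w : xi_space xi) : R :=
  xi_g xi (xi_X s w).

Definition xi_mean (R : realType) (C : nat) (xi : mechanism R C)
    (s : 'cV[R]_C) : R :=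
  fine 'E_(xi_law xi)[xi_X s].

Definition xi_variance (R : realType) (C : nat) (xi : mechanism R C)
    (s : 'cV[R]_C) : R :=
  fine 'V_(xi_law xi)[xi_X s].

Definition bias_asym (R : realType) (C : nat) (xi : mechanism R C)
    (s : 'cV[R]_C) : R :=
  xi_g xi (xi_mean xi s) - log_partition s.

Definition bias_curv (R : realType) (C : nat) (xi : mechanism R C)
    (s : 'cV[R]_C) : R :=
  2^-1 * derive1n 2 (xi_g xi) (xi_mean xi s) * xi_variance xi s.

(* No randomness: every event is almost sure or almost impossible. *)
Definition deterministic (R : realType) (C : nat) (xi : mechanism R C) : Prop :=
  forall A : set (xi_space xi), measurable A ->
    xi_law xi A = 0%E \/ xi_law xi A = 1%E.

(* A function f is regarded as a deterministic approximation of the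
   log-partition function when its value at each s is the (almost sure) output
   of a deterministic mechanism. That mechanism may depend on s, since an
   average of terms that each see a single score cannot carry a general f. *)
Definition deterministic_representation (R : realType) (C : nat)
    (f : 'cV[R]_C -> R) (xi : 'cV[R]_C -> mechanism R C) : Prop :=
  forall s, deterministic (xi s) /\
    {ae xi_law (xi s), forall w, xi_approx s w = f s}.

Lemma derive1n_cst (R : realType) (c : R) (m : nat) :
  exists c' : R, derive1n m (fun _ : R => c) = (fun _ : R => c').
Proof.
elim: m => [|m [c' IH]]; first by exists c.
exists 0; rewrite derive1nS IH; apply/funext => x.
exact: derive1_cst.
Qed.

Lemma smooth_on_cst (R : realType) (D : set R) (c : R) :
  smooth_on D (fun _ : R => c).
Proof.
move=> m x _; have [c' ->] := derive1n_cst c m.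
exact: derivable_cst.
Qed.

Lemma deterministic_representation_exists (R : realType) (C : nat)
    (f : 'cV[R]_C -> R) (C_gt0 : (0 < C)%N) :
  exists xi, deterministic_representation f xi.
Proof.
pose law : probability unit R := \d_tt.
pose y (j : 'I_1) (w : unit) := Ordinal C_gt0.
have ym (j : 'I_1) (c : 'I_C) : measurable (y j @^-1` [set c]) by [].
have yid (i j : 'I_1) (c : 'I_C) :
  law (y i @^-1` [set c]) = law (y j @^-1` [set c]) by [].
have yind (c : 'I_1 -> 'I_C) : law [set w | forall j, y j w = c j] =
    (\prod_(j < 1) law (y j @^-1` [set c j]))%E.
  rewrite big_ord1; congr (law _); apply/seteqP; split => w /=.
    by move=> /(_ ord0).
  by move=> yc j; rewrite (ord1 j).
have oT : open (setT : set R) := openT.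
have iT : is_interval (setT : set R) by [].
exists (fun s => @Mechanism R C _ _ law 1 y (cst 0) (cst (f s)) setT isT ym yid
  yind oT iT (fun=> I) (@smooth_on_cst R setT 0)
  (@smooth_on_cst R setT (f s))) => s; split.
  move=> A _; rewrite /= diracE.
  by case: (tt \in A); [right|left].
by apply: aeW => w.
Qed.

(* Main.v *)
(* Asymptotic bias: write log-sum-exp as ln C + ln (1 + u), where u is the
   average of e^(s_j) - 1.  Third-order remainder bounds for exp at 0 and for
   ln at 1 then give the cubic estimate.
   Curvature bias: in a deterministic mechanism each sampled class has an atom
   of probability 1, so X(xi) is almost surely constant; its variance is zero
   and g at its mean is the almost sure output. *)

Require Import Defs.
From HB Require Import structures.
From mathcomp Require Import all_boot all_order all_algebra.
From mathcomp Require Import all_classical all_reals all_analysis measurable_realfun.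
From mathcomp Require Import ring lra.

Import Order.TTheory GRing.Theory Num.Theory.
Import numFieldNormedType.Exports.

Local Open Scope classical_set_scope.
Local Open Scope ring_scope.

(** * Directional derivatives of log-sum-exp *)

(** Both sides have literally the same difference quotient. This transports one-variable rules, the
    chain rule in particular, to directional derivatives. *)
Lemma is_derive_line (R : realType) (V : normedModType R) (f : V -> R)
    (a v : V) (d : R) :
  is_derive (0 : R) 1 (fun t : R => f (t *: v + a)) d <-> is_derive a v f d.
Proof.
have E : (fun h : R => h^-1 *: (((fun t : R => f (t *: v + a)) \o shift 0)
      (h *: (1 : R)) - (fun t : R => f (t *: v + a)) 0)) =
    (fun h => h^-1 *: ((f \o shift a) (h *: v) - f a)).
  apply/funext => h /=; rewrite scale0r add0r addr0.
  by rewrite [h *: 1]mulr1.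
split=> -[df dE]; split.
- by rewrite /derivable -E; exact: df.
- by rewrite /derive -E; exact: dE.
- by rewrite /derivable E; exact: df.
- by rewrite /derive E; exact: dE.
Qed.

Lemma is_derive_comp (R : realType) (V : normedModType R) (g : R -> R)
    (f : V -> R) (a v : V) (dg df : R) :
  is_derive (f a) 1 g dg -> is_derive a v f df ->
  is_derive a v (g \o f) (dg * df).
Proof.
move=> gdg /is_derive_line fdf; apply/is_derive_line.
by apply: is_derive1_comp fdf; rewrite scale0r add0r.
Qed.

Lemma is_derive_coord (R : realType) (C : nat) (j : 'I_C) (a v : 'cV[R]_C) :
  is_derive a v (fun s : 'cV[R]_C => s j 0) (v j 0).
Proof.
apply/is_derive_line.
have -> : (fun t : R => (t *: v + a) j 0) = (v j 0 *: id) + cst (a j 0).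
  by apply/funext => t; rewrite !mxE /= mulrC.
by apply: is_derive_eq; rewrite addr0 [_ *: _]mulr1.
Qed.

Lemma sum_expR_gt0 (R : realType) (C : nat) (s : 'cV[R]_C) : (0 < C)%N ->
  0 < \sum_(j < C) expR (s j 0).
Proof.
move=> C_gt0; rewrite (bigD1 (Ordinal C_gt0)) //=.
by rewrite ltr_wpDr ?expR_gt0 // sumr_ge0 // => j _; rewrite ltW ?expR_gt0.
Qed.

(** The weights are the softmax of [a]. Writing them as [expR (a j 0 - log_partition a)] rather than
    as quotients lets the second derivative follow from the chain rule for [expR]. *)
Lemma is_derive_log_partition (R : realType) (C : nat) (a v : 'cV[R]_C) :
  (0 < C)%N ->
  is_derive a v (@log_partition R C)
    (\sum_(j < C) expR (a j 0 - log_partition a) * v j 0).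
Proof.
move=> C_gt0; have Z_gt0 := @sum_expR_gt0 R C a C_gt0.
have dZ : is_derive a v (\sum_(j < C) (fun s : 'cV[R]_C => expR (s j 0)))
    (\sum_(j < C) expR (a j 0) * v j 0).
  apply: is_derive_sum => j.
  exact: (@is_derive_comp R _ (@expR R) _ a v _ _ (is_derive_expR _) (is_derive_coord R C j a v)).
have lnZ : is_derive ((\sum_(j < C) (fun s : 'cV[R]_C => expR (s j 0))) a) 1
    (@ln R) (\sum_(j < C) expR (a j 0))^-1.
  by rewrite fct_sumE; exact: is_derive1_ln.
have -> : \sum_(j < C) expR (a j 0 - log_partition a) * v j 0 =
    (\sum_(j < C) expR (a j 0))^-1 * \sum_(j < C) expR (a j 0) * v j 0.
  rewrite mulr_sumr; apply: eq_bigr => j _.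
  by rewrite expRB lnK ?posrE // mulrAC mulrC.
have -> : @log_partition R C =
    @ln R \o \sum_(j < C) (fun s : 'cV[R]_C => expR (s j 0)).
  by apply/funext => s /=; rewrite fct_sumE.
exact: (@is_derive_comp R _ (@ln R) _ a v _ _ lnZ dZ).
Qed.

Lemma log_partition0 (R : realType) (C : nat) :
  log_partition (0 : 'cV[R]_C) = ln C%:R.
Proof.
rewrite /log_partition; under eq_bigr do rewrite mxE expR0.
by rewrite sumr_const card_ord.
Qed.

Lemma expR_Nlog_partition0 (R : realType) (C : nat) : (0 < C)%N ->
  expR (- log_partition (0 : 'cV[R]_C)) = C%:R^-1.
Proof. by move=> C_gt0; rewrite log_partition0 expRN lnK // posrE ltr0n. Qed.

Lemma derive_log_partition (R : realType) (C : nat) (i : 'I_C) (a : 'cV[R]_C) :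
  'D_(delta_mx i 0) (@log_partition R C) a = expR (a i 0 - log_partition a).
Proof.
have C_gt0 : (0 < C)%N by apply: leq_ltn_trans (ltn_ord i).
have := @is_derive_log_partition R C a (delta_mx i 0) C_gt0.
move=> /@derive_val ->; rewrite (bigD1 i) //= mxE !eqxx mulr1.
rewrite big1 ?addr0 // => j ji.
by rewrite mxE (negbTE ji) mulr0.
Qed.

Lemma derive2_log_partition0 (R : realType) (C : nat) (i j : 'I_C) :
  'D_(delta_mx i 0) ('D_(delta_mx j 0) (@log_partition R C)) 0 =
  C%:R^-1 * ((i == j)%:R - C%:R^-1) :> R.
Proof.
have C_gt0 : (0 < C)%N by apply: leq_ltn_trans (ltn_ord i).
rewrite (_ : 'D__ _ = expR \o ((fun s : 'cV[R]_C => s j 0) - @log_partition R C)); last first.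
  by apply/funext => s; rewrite derive_log_partition.
pose e : 'cV[R]_C := delta_mx i 0.
have dl := @is_derive_log_partition R C 0 e C_gt0.
have dj := is_derive_coord R C j 0 e.
have /@derive_val -> := @is_derive_comp R _ (@expR R) _ 0 e _ _
  (is_derive_expR _) (is_deriveB dj dl).
(* The sum supplied by [dl] is folded back into a partial derivative, whose closed form is already
   known. *)
rewrite -(@derive_val _ _ _ _ _ _ _ dl) derive_log_partition !fctE /e !mxE.
by rewrite eqxx andbT !sub0r expR_Nlog_partition0 // eq_sym.
Qed.

(** * The quadratic approximation as a Taylor polynomial *)

(** The quadratic form is the variance of the scores under the uniform law on classes: mean of
    squares minus square of the mean. *)
Lemma OmegaRGE (R : realType) (C : nat) (s : 'cV[R]_C) :
  OmegaRG s = ln C%:R + C%:R^-1 * \sum_(j < C) s j 0 +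
    2^-1 * (C%:R^-1 * \sum_(j < C) s j 0 ^+ 2 -
            (C%:R^-1 * \sum_(j < C) s j 0) ^+ 2).
Proof.
rewrite /OmegaRG; congr (_ + _ * _).
rewrite mulmxBr mulmxBl -!scalemxAr mulmx1 -!scalemxAl [LHS]mxE.
congr (_ + _); first rewrite [LHS]mxE.
  by congr (_ * _); rewrite mxE; apply: eq_bigr => j _; rewrite mxE expr2.
rewrite [LHS]mxE; congr (- _); rewrite [LHS]mxE exprMn exprVn.
have -> : s^T *m ((const_mx 1 : 'cV[R]_C) *m (const_mx 1)^T) *m s =
    (s^T *m (const_mx 1 : 'cV[R]_C)) *m ((const_mx 1 : 'cV[R]_C)^T *m s).
  by rewrite !mulmxA.
congr (_ * _); rewrite mxE big_ord1 expr2 !mxE; congr (_ * _).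
  by apply: eq_bigr => j _; rewrite !mxE mulr1.
by apply: eq_bigr => j _; rewrite !mxE mul1r.
Qed.

Lemma OmegaRG_taylor2 (R : realType) (C : nat) (s : 'cV[R]_C) : (0 < C)%N ->
  OmegaRG s = taylor2 (@log_partition R C) 0 s.
Proof.
move=> C_gt0; rewrite OmegaRGE /taylor2 log_partition0 subr0.
congr (_ + _ + _ * _).
  rewrite mulr_sumr; apply: eq_bigr => i _.
  by rewrite derive_log_partition mxE sub0r expR_Nlog_partition0.
under [RHS]eq_bigr => i _.
  under eq_bigr => j _.
    rewrite derive2_log_partition0.
    (* The diagonal part of the Hessian yields the mean of squares, the rank-one part the squared
       mean. *)
    have -> : C%:R^-1 * ((i == j)%:R - C%:R^-1) * s i 0 * s j 0 =
      C%:R^-1 * s i 0 * ((i == j)%:R * s j 0)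
      - C%:R^-1 * s i 0 * (C%:R^-1 * s j 0) by ring.
    over.
  rewrite sumrB -!mulr_sumr (bigD1 i) //= eqxx mul1r big1 ?addr0; last first.
    by move=> j; rewrite eq_sym => /negbTE ->; rewrite mul0r.
  over.
rewrite sumrB expr2 mulr_sumr; congr (_ - _).
  by apply: eq_bigr => i _; rewrite expr2 mulrA.
by rewrite mulr_sumr mulr_suml; apply: eq_bigr => i _; rewrite mulr_sumr.
Qed.

(** * Taylor remainder bounds for exp and ln *)

(** By the mean value theorem [f x = df c * x] for some [c] between 0 and [x]. Each use raises the
    order of a bound by one and keeps the constant [K], so no factorials appear below. *)
Lemma norm_le_pow_of_derive (R : realType) (f df : R -> R) (r K : R) (n : nat) :
  0 <= K -> f 0 = 0 ->
  (forall x : R, `|x| <= r -> is_derive x 1 f (df x)) ->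
  (forall x : R, `|x| <= r -> `|df x| <= K * `|x| ^+ n) ->
  forall x : R, `|x| <= r -> `|f x| <= K * `|x| ^+ n.+1.
Proof.
move=> K_ge0 f0 fdf dfK x xr.
have bound c : `|c| <= `|x| -> f x = df c * x -> `|f x| <= K * `|x| ^+ n.+1.
  move=> cx ->; rewrite normrM exprSr mulrA ler_wpM2r //.
  apply: le_trans (dfK c (le_trans cx xr)) _.
  by rewrite ler_wpM2l // lerXn2r ?nnegrE.
have cont (a b : R) : `|a| <= r -> `|b| <= r -> {within `[a, b], continuous f}.
  move=> ar br; apply: derivable_within_continuous => y.
  rewrite in_itv /= => /andP[ay yb].
  have /fdf [] // : `|y| <= r.
  by move: ar br; rewrite !ler_norml; lra.
have r_ge0 : `|0 : R| <= r by rewrite normr0 (le_trans _ xr).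
case: (leP 0 x) => x0.
  have [y|c] := @MVT_segment R f df 0 x x0 _ (cont _ _ r_ge0 xr).
    rewrite in_itv /= => /andP[y0 yx]; apply: fdf; apply: le_trans xr.
    by rewrite !ger0_norm // ltW.
  rewrite in_itv /= f0 !subr0 => /andP[c0 cx]; apply: bound.
  by rewrite !ger0_norm.
have [y|c] := @MVT_segment R f df x 0 (ltW x0) _ (cont _ _ xr r_ge0).
  rewrite in_itv /= => /andP[xy y0]; apply: fdf; apply: le_trans xr.
  by rewrite !ltr0_norm // lerN2 ltW.
rewrite in_itv /= f0 !sub0r mulrN => /andP[xc c0] /oppr_inj; apply: bound.
by rewrite ler0_norm // ltr0_norm // lerN2.
Qed.

(** Inverts [expR (- x) >= 1 - x >= 2^-1]. This starts the chain of three exponential bounds, each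
    remainder being the derivative of the next. *)
Lemma expR_le2 (R : realType) (x : R) : `|x| <= 2^-1 -> expR x <= 2.
Proof.
rewrite ler_norml => /andP[_ x_le].
rewrite -[x]opprK expRN -[leRHS]invrK lef_pV2 ?posrE ?expR_gt0 ?invr_gt0 //.
by apply: le_trans (expR_ge1Dx _); lra.
Qed.

Lemma norm_expR_sub1 (R : realType) (x : R) : `|x| <= 2^-1 ->
  `|expR x - 1| <= 2 * `|x|.
Proof.
have := @norm_le_pow_of_derive R (@expR R - cst 1) expR 2^-1 2 0%N.
apply=> //; first by rewrite !fctE expR0 subrr.
  by move=> y _; apply: is_derive_eq; rewrite subr0.
by move=> y /expR_le2; rewrite expr0 mulr1 ger0_norm ?expR_ge0.
Qed.

Lemma norm_expR_sub_taylor1 (R : realType) (x : R) : `|x| <= 2^-1 ->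
  `|expR x - 1 - x| <= 2 * `|x| ^+ 2.
Proof.
have := @norm_le_pow_of_derive R (@expR R - cst 1 - id)
  (fun x => expR x - 1) 2^-1 2 1%N.
apply=> //; first by rewrite !fctE expR0; ring.
  by move=> y _; apply: is_derive_eq; rewrite subr0.
by move=> y /norm_expR_sub1.
Qed.

Lemma norm_expR_sub_taylor2 (R : realType) (x : R) : `|x| <= 2^-1 ->
  `|expR x - 1 - x - 2^-1 * x ^+ 2| <= 2 * `|x| ^+ 3.
Proof.
have := @norm_le_pow_of_derive R
  (@expR R - cst 1 - id - 2^-1 *: (id : R -> R) ^+ 2)
  (fun x => expR x - 1 - x) 2^-1 2 2%N.
apply=> //; first by rewrite !fctE expR0 /GRing.scale /=; ring.
  by move=> y _; apply: is_derive_eq; rewrite /GRing.scale /= expr1; field.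
by move=> y /norm_expR_sub_taylor1.
Qed.

(** The remainder has derivative [u ^+ 2 / (1 + u)], and [1 + u >= 2^-1] gives the constant 2. *)
Lemma norm_ln1D_sub_taylor2 (R : realType) (u : R) : `|u| <= 2^-1 ->
  `|ln (1 + u) - (u - 2^-1 * u ^+ 2)| <= 2 * `|u| ^+ 3.
Proof.
have := @norm_le_pow_of_derive R
  (@ln R \o (cst 1 + id) - (id - 2^-1 *: (id : R -> R) ^+ 2))
  (fun u => u ^+ 2 / (1 + u)) 2^-1 2 2%N.
apply=> //; first by rewrite !fctE /= addr0 ln1 /GRing.scale /=; ring.
  move=> y; rewrite ler_norml => /andP[ylo yhi].
  have y1 : 0 < (cst 1 + id : R -> R) y by rewrite !fctE; lra.
  have dln := is_derive1_ln y1.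
  by apply: is_derive_eq; rewrite !fctE /GRing.scale /= expr1; field; lra.
move=> y; rewrite ler_norml => /andP[ylo yhi].
rewrite normrM normrX mulrC ler_wpM2r ?exprn_ge0 //.
rewrite normfV ger0_norm; last by lra.
by rewrite -[leRHS]invrK lef_pV2 ?posrE; lra.
Qed.

(** * The cubic error estimate *)

Lemma norm_avg_le (R : realType) (C : nat) (f : 'I_C -> R) (B : R) :
  (0 < C)%N -> (forall j, `|f j| <= B) -> `|C%:R^-1 * \sum_(j < C) f j| <= B.
Proof.
move=> C_gt0 fB; rewrite normrM ger0_norm ?invr_ge0 //.
rewrite mulrC ler_pdivrMr ?ltr0n //.
apply: le_trans (ler_norm_sum _ _ _) _.
apply: le_trans (ler_sum _ (fun j _ => fB j)) _.
by rewrite sumr_const card_ord mulr_natr.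
Qed.

(** The threshold [4^-1] forces [|u| <= 2^-1], as the logarithm bound requires. Keeping [M] separate
    from it allows [M] to be the Euclidean norm while smallness is measured in the sup norm. *)
Lemma OmegaRG_sub_log_partition_le (R : realType) (C : nat) (s : 'cV[R]_C)
    (M : R) : (0 < C)%N ->
  (forall j, `|s j 0| <= M) -> (forall j, `|s j 0| <= 4^-1) ->
  `|OmegaRG s - log_partition s| <= 21 * M ^+ 3.
Proof.
move=> C_gt0 sM s4.
have C_neq0 : C%:R != 0 :> R by rewrite pnatr_eq0 -lt0n.
pose A (f : 'I_C -> R) := C%:R^-1 * \sum_(j < C) f j.
have AB f g : A (fun j => f j - g j) = A f - A g by rewrite /A sumrB mulrBr.
have AZ c f : A (fun j => c * f j) = c * A f by rewrite /A -mulr_sumr mulrCA.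
have s2 j : `|s j 0| <= 2^-1 by apply: le_trans (s4 j) _; lra.
have M_ge0 : 0 <= M by apply: le_trans (sM (Ordinal C_gt0)).
pose m1 := A (fun j => s j 0); pose m2 := A (fun j => s j 0 ^+ 2).
pose u := A (fun j => expR (s j 0) - 1).
have m1M : `|m1| <= M by apply: norm_avg_le.
have uM : `|u| <= 2 * M.
  apply: norm_avg_le => // j; apply: le_trans (norm_expR_sub1 _ _ (s2 j)) _.
  by rewrite ler_wpM2l.
have u2 : `|u| <= 2^-1.
  apply: norm_avg_le => // j; apply: le_trans (norm_expR_sub1 _ _ (s2 j)) _.
  by have := s4 j; lra.
have um1 : `|u - m1| <= 2 * M ^+ 2.
  rewrite /u /m1 -AB; apply: norm_avg_le => // j.
  apply: le_trans (norm_expR_sub_taylor1 _ _ (s2 j)) _.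
  by rewrite ler_wpM2l // lerXn2r ?nnegrE.
have um2 : `|u - m1 - 2^-1 * m2| <= 2 * M ^+ 3.
  rewrite /u /m1 /m2 -AB -AZ -AB; apply: norm_avg_le => // j.
  apply: le_trans (norm_expR_sub_taylor2 _ _ (s2 j)) _.
  by rewrite ler_wpM2l // lerXn2r ?nnegrE.
have lnu : `|ln (1 + u) - (u - 2^-1 * u ^+ 2)| <= 16 * M ^+ 3.
  apply: le_trans (norm_ln1D_sub_taylor2 _ _ u2) _.
  have -> : 16 * M ^+ 3 = 2 * (2 * M) ^+ 3 by ring.
  by rewrite ler_wpM2l // lerXn2r ?nnegrE // mulr_ge0.
(* Replacing [u ^+ 2] by [m1 ^+ 2] costs only third order: the difference [u - m1] is quadratic and
   the sum [u + m1] is linear in [M]. *)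
have sq : `|2^-1 * ((u - m1) * (u + m1))| <= 3 * M ^+ 3.
  rewrite !normrM ger0_norm //.
  have -> : 3 * M ^+ 3 = 2^-1 * ((2 * M ^+ 2) * (2 * M + M)) by field.
  rewrite ler_wpM2l // ler_pM //.
  by apply: le_trans (ler_normD _ _) _; rewrite lerD.
have -> : log_partition s = ln C%:R + ln (1 + u).
  have Cu : \sum_(j < C) expR (s j 0) = C%:R * (1 + u).
    rewrite /u /A sumrB sumr_const card_ord mulrDr mulrA divff // mul1r mulr1.
    by rewrite addrC subrK.
  have Z_gt0 := sum_expR_gt0 R C s C_gt0.
  rewrite /log_partition Cu lnM // posrE ?ltr0n //.
  by move: Z_gt0; rewrite Cu pmulr_rgt0 ?ltr0n.
rewrite OmegaRGE -/(A (fun j => s j 0)) -/(A (fun j => s j 0 ^+ 2)) -/m1 -/m2.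
(* The error splits exactly into the terms bounded by [sq], [um2] and [lnu], hence 3 + 2 + 16 =
   21. *)
have -> : ln C%:R + m1 + 2^-1 * (m2 - m1 ^+ 2) - (ln C%:R + ln (1 + u)) =
  2^-1 * ((u - m1) * (u + m1)) - (u - m1 - 2^-1 * m2)
  - (ln (1 + u) - (u - 2^-1 * u ^+ 2)) by ring.
apply: le_trans (ler_normB _ _) _.
have := ler_normB (2^-1 * ((u - m1) * (u + m1))) (u - m1 - 2^-1 * m2).
by lra.
Qed.

Lemma norm_entry_le (R : realType) (C : nat) (s : 'cV[R]_C) (j : 'I_C) :
  `|s j 0| <= `|s|.
Proof.
rewrite [leRHS]mx_normrE.
exact: (@le_bigmax _ R _ 0 (fun i : 'I_C * 'I_1 => `|s i.1 i.2|) (j, 0)).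
Qed.

Lemma norm_entry_le_l2norm (R : realType) (C : nat) (s : 'cV[R]_C) (j : 'I_C) :
  `|s j 0| <= l2norm s.
Proof.
rewrite -sqrtr_sqr ler_wsqrtr // (bigD1 j) //= lerDl.
by apply: sumr_ge0 => i _; rewrite sqr_ge0.
Qed.

Lemma OmegaRG_sub_log_partition_bigO (R : realType) (C : nat) : (0 < C)%N ->
  (fun s : 'cV[R]_C => OmegaRG s - log_partition s) =O_ (nbhs (0 : 'cV[R]_C))
    (fun s : 'cV[R]_C => l2norm s ^+ 3).
Proof.
move=> C_gt0; apply/eqO_exP; exists 21 => //.
apply: (@filterS _ _ _ [set s : 'cV[R]_C | `|s| <= 4^-1]); last first.
  apply: (@nbhs0_le R 'cV[R]_C 4^-1); lra.
move=> s s4; have l2_ge0 : 0 <= l2norm s by rewrite /l2norm sqrtr_ge0.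
rewrite (ger0_norm (exprn_ge0 _ l2_ge0)).
apply: OmegaRG_sub_log_partition_le => // j.
  exact: norm_entry_le_l2norm.
exact: le_trans (norm_entry_le _ _ _ _) s4.
Qed.

(** * Almost sure constancy of deterministic mechanisms *)

(* A class with probability 1 exists because the probabilities of the finitely
   many classes, each 0 or 1, sum to 1. *)
Lemma deterministic_class_ae_cst (R : realType) (C : nat) (xi : mechanism R C) :
  deterministic xi -> exists c : 'I_(xi_k xi) -> 'I_C,
    {ae xi_law xi, forall w, forall j, xi_y j w = c j}.
Proof.
move=> det; have P_gt0 : (0 < xi_law xi setT)%E by rewrite probability_setT.
have ae_proper := ae_properfilter_algebraOfSetsType P_gt0.
have [c yc] : exists c : 'I_(xi_k xi) -> 'I_C,
    forall j, xi_law xi (xi_y j @^-1` [set c j]) = 1%E.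
  suff /boolp.choice : forall j : 'I_(xi_k xi), exists c : 'I_C,
    xi_law xi (xi_y j @^-1` [set c]) = 1%E by case=> c; exists c.
  move=> j.
  (* Otherwise every class is null, so almost surely [xi_y j w] avoids all classes at once. Since
     the almost-sure filter is proper, some [w] does so, which is absurd at the class [xi_y j w]. *)
  apply: contrapT => no1; have y0 c : {ae xi_law xi, forall w, xi_y j w <> c}.
    have [y0|y1] := det _ (xi_y_measurable j c); last by case: no1; exists c.
    exists (xi_y j @^-1` [set c]); split => //; first exact: xi_y_measurable.
    by move=> w /= /contrapT.
  have /filter_ex [w /(_ (xi_y j w))] : {ae xi_law xi, forall w c, xi_y j w <> c}.
    exact: filter_forall y0.
  by [].
exists c; apply: filter_forall => j.
exists (~` (xi_y j @^-1` [set c j])); split => //.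
  by apply: measurableC; exact: xi_y_measurable.
by rewrite probability_setC ?yc ?subee //; exact: xi_y_measurable.
Qed.

(** Each term factors through a finite set of classes, so the preimage of any set is a finite union
    of measurable atoms. *)
Lemma measurable_xi_X (R : realType) (C : nat) (xi : mechanism R C)
    (s : 'cV[R]_C) : measurable_fun setT (xi_X (xi := xi) s).
Proof.
apply: measurable_funM => //; apply: measurable_sum => j _ Y _.
rewrite setTI [X in measurable X](_ : _ =
    \bigcup_(c in [set c | Y (xi_h xi (s c 0))]) (xi_y j @^-1` [set c])).
  by apply: fin_bigcup_measurable => // c _; exact: xi_y_measurable.
apply/seteqP; split => w /=; first by exists (xi_y j w).
by case=> c /= Yc ->.
Qed.

Lemma ae_eq_expectation (d : measure_display) (T : measurableType d)
    (R : realType) (P : probability T R) (X Y : T -> R) :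
  measurable_fun setT X -> measurable_fun setT Y ->
  {ae P, forall w, X w = Y w} -> ('E_P[X] = 'E_P[Y])%E.
Proof.
move=> mX mY XY; rewrite unlock; apply: ae_eq_integral => //.
- exact/measurable_EFinP.
- exact/measurable_EFinP.
- by apply: filterS XY => w XYw _; rewrite XYw.
Qed.

Lemma ae_cst_expectation (d : measure_display) (T : measurableType d)
    (R : realType) (P : probability T R) (X : T -> R) (c : R) :
  measurable_fun setT X -> {ae P, forall w, X w = c} -> ('E_P[X] = c%:E)%E.
Proof.
move=> mX Xc; rewrite -(expectation_cst P).
exact: ae_eq_expectation.
Qed.

Lemma ae_cst_variance (d : measure_display) (T : measurableType d)
    (R : realType) (P : probability T R) (X : T -> R) (c : R) :
  measurable_fun setT X -> {ae P, forall w, X w = c} -> ('V_P[X] = 0)%E.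
Proof.
move=> mX Xc; rewrite /variance covariance.unlock (ae_cst_expectation _ _ _ _ _ _ mX Xc) /=.
apply: ae_cst_expectation.
  by apply: measurable_funM; apply: measurable_funB.
by apply: filterS Xc => w Xw; rewrite fctE /= Xw subrr mul0r.
Qed.

Lemma deterministic_xi_X_ae_cst (R : realType) (C : nat) (xi : mechanism R C)
    (s : 'cV[R]_C) : deterministic xi ->
  {ae xi_law xi, forall w, xi_X s w = xi_mean xi s} /\ xi_variance xi s = 0.
Proof.
move=> /deterministic_class_ae_cst [c yc]; have mX := measurable_xi_X R C xi s.
have Xc : {ae xi_law xi, forall w, xi_X s w =
    (xi_k xi)%:R^-1 * \sum_(j < xi_k xi) xi_h xi (s (c j) 0)}.
  apply: filterS yc => w yw; congr (_ * _).
  by apply: eq_bigr => j _; rewrite yw.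
rewrite /xi_mean /xi_variance (ae_cst_expectation _ _ _ _ _ _ mX Xc).
by rewrite (ae_cst_variance _ _ _ _ _ _ mX Xc).
Qed.

Lemma deterministic_bias (R : realType) (C : nat) (f : 'cV[R]_C -> R)
    (xi : 'cV[R]_C -> mechanism R C) (s : 'cV[R]_C) :
  deterministic_representation f xi ->
  bias_asym (xi s) s = f s - log_partition s /\ bias_curv (xi s) s = 0.
Proof.
move=> /(_ s) [det Xf]; have [Xmean var0] := deterministic_xi_X_ae_cst _ _ _ s det.
split; last by rewrite /bias_curv var0 mulr0.
rewrite /bias_asym; congr (_ - _).
have P_gt0 : (0 < xi_law (xi s) setT)%E by rewrite probability_setT.
have ae_proper := ae_properfilter_algebraOfSetsType P_gt0.
(* Two almost sure events share a point [w], where [xi_X s w] equals the mean and its image under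
   [xi_g] equals [f s]. *)
have [w [<- <-]] := filter_ex (filterI Xmean Xf).
by [].
Qed.

Theorem mainTheorem14 (R : realType) (C : nat) (C_gt0 : (0 < C)%N)
    (xi : 'cV[R]_C -> mechanism R C)
    (xi_RG : deterministic_representation (@OmegaRG R C) xi) :
  [/\ forall s : 'cV[R]_C, OmegaRG s = taylor2 (@log_partition R C) 0 s,
      forall s : 'cV[R]_C,
        bias_asym (xi s) s = OmegaRG s - ln (\sum_(j < C) expR (s j 0)),
      (fun s : 'cV[R]_C => bias_asym (xi s) s) =O_ (nbhs (0 : 'cV[R]_C))
        (fun s : 'cV[R]_C => l2norm s ^+ 3)
    & forall s : 'cV[R]_C, bias_curv (xi s) s = 0].
Proof.
have biasE s := deterministic_bias R C (@OmegaRG R C) xi s xi_RG.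
split=> [s|s||s]; first exact: OmegaRG_taylor2.
- exact: (biasE s).1.
- have -> : (fun s => bias_asym (xi s) s) =
      (fun s => OmegaRG s - log_partition s).
    by apply/funext => s; exact: (biasE s).1.
  exact: OmegaRG_sub_log_partition_bigO.
- exact: (biasE s).2.
Qed.
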